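(* Let $n$ be a positive integer and let $r$ be an arbitrary integer. Then, as a congruence between rational functions in the indeterminate $q$, $$\sum_{k=0}^{n-1}q^{r(n-k)^2+(r-1)k}{n+k\brack k}^{2r}{n-1\brack k}^{2r}\equiv q^{(r-1)n+1}[n]-\frac{r(2r-1)(n-1)^2q(1-q)^2}{4}[n]^3\pmod{[n]\Phi_n(q)^3}.$$
   Context: Here $q$ is an indeterminate. The $q$-shifted factorials are $(a;q)_0=1$ and $(a;q)_m=(1-a)(1-aq)\cdots(1-aq^{m-1})$ for $m\ge 1$. The Gaussian $q$-binomial coefficients are $${m\brack k}=\frac{(q;q)_m}{(q;q)_k(q;q)_{m-k}}\quad\text{if } 0\le k\le m,$$ and ${m\brack k}=0$ otherwise. The $q$-integers are $[m]=(1-q^m)/(1-q)$. The $n$th cyclotomic polynomial is $$\Phi_n(q)=\prod_{\substack{1\le k\le n\\ \gcd(n,k)=1}}(q-\zeta^k),$$ where $\zeta$ is a primitive $n$th root of unity. Congruences of rational functions: for polynomials $A_1(q),A_2(q),P(q)\in\mathbb{Z}[q]$, the congruence $A_1(q)/A_2(q)\equiv 0\pmod{P(q)}$ means that $A_1(q)$ is divisible by $P(q)$ and $A_2(q)$ is coprime with $P(q)$ (divisibility and coprimality may be understood in $\mathbb{Q}[q]$, so nonzero constant denominators are harmless). For rational functions $A(q),B(q)\in\mathbb{Q}(q)$ and $P(q)\in\mathbb{Z}[q]$, $A(q)\equiv B(q)\pmod{P(q)}$ means that $A(q)-B(q)\equiv 0\pmod{P(q)}$, i.e. $A(q)-B(q)$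 can be written as such a fraction $A_1(q)/A_2(q)$. When $r$ is negative, negative powers of $q$ and of $q$-binomial coefficients are interpreted in $\mathbb{Q}(q)$. *)

(* Defs.v *)
From mathcomp Require Import all_boot all_order all_algebra all_field.

Set Implicit Arguments.
Unset Strict Implicit.
Unset Printing Implicit Defensive.

Import GRing.Theory.
Local Open Scope ring_scope.

Definition qpoch (F : fieldType) (q a : F) (m : nat) : F :=
  \prod_(i < m) (1 - a * q ^+ i).

Definition qbinom (F : fieldType) (q : F) (m k : nat) : F :=
  if (k <= m)%N then qpoch q q m / (qpoch q q k * qpoch q q (m - k)) else 0.

Definition qint (F : fieldType) (q : F) (m : nat) : F :=
  (1 - q ^+ m) / (1 - q).

Notation Qq := {fraction {poly rat}}.

Definition qX : Qq := tofrac 'X.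

Definition pZtoQ (p : {poly int}) : {poly rat} := map_poly intr p.

Definition pZtoQq (p : {poly int}) : Qq := tofrac (pZtoQ p).

(* A = B modulo M.  The modulus is given as an element of Q(q), so that the
   fraction [n] can occur in it, but it has to be (the image of) a polynomial P
   with integer coefficients; P is unique because pZtoQq is injective.
   Divisibility and coprimality are those of Q[q].
   The condition A2 != 0 only matters when P is a nonzero constant: 0 is then
   coprime to P, and A1 / 0 would be 0. *)
Definition Qq_congr (M A B : Qq) : Prop :=
  exists P A1 A2 : {poly int},
    [/\ M = pZtoQq P,
        A2 != 0,
        A - B = pZtoQq A1 / pZtoQq A2,
        pZtoQ P %| pZtoQ A1
      & coprimep (pZtoQ A2) (pZtoQ P)].

(* Main.v *)
Require Import Defs.
From HB Require Import structures.
From mathcomp Require Import all_boot all_order all_algebra all_field.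
From mathcomp Require Import ring zify.

Set Implicit Arguments.
Unset Strict Implicit.
Unset Printing Implicit Defensive.

Import GRing.Theory Num.Theory.
Local Open Scope ring_scope.

(** Put t = 1 - q^n and w_j = q^j / (1 - q^j)^2.  Everything rests on the
    identity (1 - q^(n+j)) (1 - q^(n-j)) = - q^(n-j) ((1 - q^j)^2 - t^2 q^(j-n)):
    it turns the k-th summand into
      q^(r n^2 - k) \prod_(1 <= j <= k) u_j^(2r),  u_j = 1 - t^2 q^(-n) w_j
    (lemma summandE), where the power of q has lost its quadratic part in k and
    the product is close to 1 modulo the cyclotomic factors of [n].  As
    [n] Phi_n^3 is Phi_n^4 times the other Phi_d, with d | n and d > 1, and these
    are pairwise coprime, each of them is handled in its own localization of
    Q[q], where congruences make sense for all integers r, negative ones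
    included.

    Modulo Phi_n^4, the factor t is a multiple of Phi_n, so the product is
    1 - 2 r t^2 q^(-n) \sum_(j <= k) w_j modulo t^4.  Summing against q^(-k)
    (Abel summation) leaves \sum_j w_j q^(-j) (q^j - q^n), which is needed only
    modulo t^2; by the symmetry j -> n - j it reduces to
    \sum_j 1 / (1 - q^j) = (n - 1) / 2 - (t / 2) \sum_j w_j modulo t^2, and
    \sum_j w_j is needed only modulo t.  Its value - (n^2 - 1) / 12 comes from the
    discrete Fourier expansion 2 n w_j = \sum_i i (n - i) q^(i j), valid modulo t.
    What remains is a comparison of powers of q^n = 1 - t, expanded to second
    order.

    Modulo Phi_d with d < n, the factors u_j with d not dividing j are congruent
    to 1 and all u_j are units.  So the product is constant on each block of d
    consecutive indices k, while q^(-k) sums to 0 over such a block; both sides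
    of the congruence vanish.

    For n = 1 the modulus is Phi_1^3, while 1 - q is not invertible near Phi_1;
    there the two sides are equal. *)

(** * The summands as products of correction factors *)

Section Summand.

Variables (F : fieldType) (q : F) (n : nat).

Definition qweight (j : nat) : F := q ^+ j / (1 - q ^+ j) ^+ 2.

(** Going from k = j - 1 to k = j multiplies the product of the two q-binomials by
    - q^(n-j) times this correction factor, which for 0 < j < n takes the value 1
    when q is a primitive n-th root of unity. *)
Definition qcorr (j : nat) : F := 1 - (1 - q ^+ n) ^+ 2 / q ^+ n * qweight j.

Hypothesis q0 : q != 0.
Hypothesis qN1 : forall i, (0 < i)%N -> 1 - q ^+ i != 0.

Lemma qpoch_neq0 m : qpoch q q m != 0.
Proof. by apply/prodf_neq0 => i _; rewrite -exprS qN1. Qed.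

Lemma qpoch_addn m k :
  qpoch q q (m + k) = qpoch q q m * \prod_(i < k) (1 - q ^+ (m + i.+1)).
Proof.
rewrite /qpoch big_split_ord /=; congr (_ * _).
by apply: eq_bigr => i _; rewrite -exprS addnS.
Qed.

Lemma qpochE k : qpoch q q k = \prod_(i < k) (1 - q ^+ i.+1).
Proof. by apply: eq_bigr => i _; rewrite -exprS. Qed.

Lemma qbinom_upper_prod k :
  qbinom q (n + k) k = \prod_(i < k) ((1 - q ^+ (n + i.+1)) / (1 - q ^+ i.+1)).
Proof.
rewrite /qbinom leq_addl addnK qpoch_addn big_split /= prodfV -qpochE.
by have := qpoch_neq0 n; have := qpoch_neq0 k => ? ?; field; apply/andP.
Qed.

Lemma qbinom_lower_prod k : (k < n)%N ->
  qbinom q n.-1 k = \prod_(i < k) ((1 - q ^+ (n - i.+1)) / (1 - q ^+ i.+1)).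
Proof.
move=> lt_kn; rewrite /qbinom; have -> : (k <= n.-1)%N by lia.
rewrite -{1}(subnK (_ : k <= n.-1)%N); last lia.
rewrite qpoch_addn big_split /= prodfV -qpochE.
have -> : \prod_(i < k) (1 - q ^+ (n - i.+1))
        = \prod_(i < k) (1 - q ^+ (n.-1 - k + i.+1)).
  rewrite (reindex_inj rev_ord_inj) /=; apply: eq_bigr => i _.
  by congr (1 - q ^+ _); have := ltn_ord i; lia.
by have := qpoch_neq0 (n.-1 - k); have := qpoch_neq0 k => ? ?; field; apply/andP.
Qed.

(** Both sides come from (1 - q^(n+i)) (1 - q^(n-i))
    = (1 - q^n)^2 - q^(n-i) (1 - q^i)^2. *)
Lemma qbinom_factorE i : (0 < i <= n)%N ->
  (1 - q ^+ (n + i)) / (1 - q ^+ i) * ((1 - q ^+ (n - i)) / (1 - q ^+ i))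
  = - (q ^+ (n - i) * qcorr i).
Proof.
case/andP=> i0 lein; rewrite /qcorr /qweight.
have -> : q ^+ n = q ^+ (n - i) * q ^+ i by rewrite -exprD subnK.
have -> : q ^+ (n + i) = q ^+ (n - i) * q ^+ i * q ^+ i.
  by rewrite -!exprD; congr (_ ^+ _); lia.
have := qN1 i0; have := expf_neq0 i q0; have := expf_neq0 (n - i) q0.
move: (q ^+ (n - i)) (q ^+ i) => x y x0 y0 y1.
by field; rewrite x0 y0 y1.
Qed.

(** The powers q^(2r(n-j)) extracted from the squared q-binomials telescope the
    quadratic exponent r (n - k)^2 + (r - 1) k down to r n^2 - k. *)
Lemma summandE (r : int) k : (k < n)%N ->
  q ^ (r * (n%:Z - k%:Z) ^+ 2 + (r - 1) * k%:Z)
    * qbinom q (n + k)%N k ^ (2 * r) * qbinom q n.-1 k ^ (2 * r)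
  = q ^ (r * n%:Z ^+ 2 - k%:Z) * \prod_(i < k) qcorr i.+1 ^ (2 * r).
Proof.
move=> lt_kn; rewrite -mulrA -expfzMl qbinom_upper_prod qbinom_lower_prod //.
rewrite -big_split /=.
elim: k lt_kn => [|k IHk] lt_kn.
  rewrite !big_ord0 exp1rz; congr (q ^ _ * _); ring.
have IH := IHk (ltnW lt_kn); rewrite !big_ord_recr /= qbinom_factorE; last lia.
have ratio_pow : (- (q ^+ (n - k.+1) * qcorr k.+1)) ^ (2 * r)
   = q ^ (2 * r * (n%:Z - k.+1%:Z)) * qcorr k.+1 ^ (2 * r).
  rewrite -[LHS]exprz_exp -[(- _) ^ 2]/((- _) ^+ 2) sqrrN.
  rewrite -[(_ * _) ^+ 2]/((_ * _) ^ 2) exprz_exp expfzMl exprnP exprz_exp.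
  by rewrite -subzn ?(ltnW lt_kn) // [_ * (2 * r)]mulrC.
rewrite expfzMl ratio_pow.
move: IH; set A := (\prod_(i < k) _) ^ (2 * r).
set B := \prod_(i < k) _; set C := qcorr _ ^ _ => IH.
(* Passing from k to k + 1 lowers the total exponent of q by exactly 1. *)
transitivity ((q ^ (r * (n%:Z - k%:Z) ^+ 2 + (r - 1) * k%:Z) * A) / q * C).
  rewrite -[q^-1]/(q ^ (-1)).
  transitivity (q ^ (r * (n%:Z - k.+1%:Z) ^+ 2 + (r - 1) * k.+1%:Z)
     * q ^ (2 * r * (n%:Z - k.+1%:Z)) * (A * C)); first by ring.
  rewrite -expfzDr //.
  transitivity (q ^ (r * (n%:Z - k%:Z) ^+ 2 + (r - 1) * k%:Z) * q ^ (-1) * (A * C)).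
    by rewrite -expfzDr //; congr (q ^ _ * _); ring.
  by ring.
rewrite IH -[q^-1]/(q ^ (-1)).
transitivity (q ^ (r * n%:Z ^+ 2 - k%:Z) * q ^ (-1) * (B * C)); first by ring.
by rewrite -expfzDr //; congr (q ^ _ * _); ring.
Qed.

(** Each weight w_j is multiplied by the tail q^(-j) + ... + q^(-N) of a geometric
    series; the right-hand side is this expanded with w_j = q^j / (1 - q^j)^2. *)
Lemma abel_weight_sum N :
  (1 - q) * q ^+ N * \sum_(k < N.+1) (q ^+ k)^-1 * \sum_(i < k) qweight i.+1
  = \sum_(i < N) qweight i.+1
    - q ^+ N.+1 * \sum_(i < N) ((1 - q ^+ i.+1) ^+ 2)^-1.
Proof.
elim: N => [|N IHN]; first by rewrite big_ord1 !big_ord0 !mulr0 subr0.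
rewrite big_ord_recr /=; move: IHN; set D := \sum_(k < N.+1) _ => IHN.
transitivity (q * ((1 - q) * q ^+ N * D)
              + (1 - q) * \sum_(i < N.+1) qweight i.+1).
  by have x0 := expf_neq0 N q0; rewrite exprS; field; rewrite q0 x0.
rewrite IHN.
rewrite [in RHS]big_ord_recr [X in _ = _ - _ * X]big_ord_recr /=.
rewrite (big_ord_recr N) /= /qweight !exprS.
have := expf_neq0 N q0; have := qN1 (ltn0Sn N); rewrite exprS.
set W := \sum_(i < N) _; set V := \sum_(i < N) _; move: (q ^+ N) => x x1 x0.
by field.
Qed.

Lemma geometric_inv_sum N :
  (1 - q) * q ^+ N * \sum_(k < N.+1) (q ^+ k)^-1 = 1 - q ^+ N.+1.
Proof.
elim: N => [|N IHN]; first by rewrite big_ord1 expr0 expr1 invr1 !mulr1.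
rewrite big_ord_recr /=; move: IHN; set D := \sum_(k < N.+1) _ => IHN.
transitivity (q * ((1 - q) * q ^+ N * D) + (1 - q)).
  by have x0 := expf_neq0 N q0; rewrite exprS; field; rewrite q0 x0.
by rewrite IHN [q ^+ N.+2]exprS; ring.
Qed.

(** Closed form of the generating polynomial of i (n - i); at k = n and modulo
    1 - q^n it collapses to 2 n q (1 - q), which is how the weights get their
    discrete Fourier expansion. *)
Lemma quadratic_power_sum k :
  (1 - q) ^+ 3 * \sum_(i < k) (i%:R * (n%:R - i%:R)) * q ^+ i
  = n%:R * (1 - q) * (q - k%:R * q ^+ k + (k%:R - 1) * q ^+ k.+1)
    - (q + q ^+ 2 - k%:R ^+ 2 * q ^+ k
       + (2 * k%:R ^+ 2 - 2 * k%:R - 1) * q ^+ k.+1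
       - (k%:R - 1) ^+ 2 * q ^+ k.+2).
Proof.
elim: k => [|k IHk]; first by rewrite big_ord0; ring.
by rewrite big_ord_recr /= mulrDr IHk -natr1 !exprS; ring.
Qed.

Definition binomial_sum (r : int) : F :=
  \sum_(k < n)
     q ^ (r * (n%:Z - k%:Z) ^+ 2 + (r - 1) * k%:Z)
     * qbinom q (n + k)%N k ^ (2 * r) * qbinom q n.-1 k ^ (2 * r).

Definition binomial_sum_value (r : int) : F :=
  q ^ ((r - 1) * n%:Z + 1) * qint q n
  - (r * (2 * r - 1) * (n%:Z - 1) ^+ 2)%:~R * q * (1 - q) ^+ 2 / 4
    * qint q n ^+ 3.

Lemma binomial_sumE r :
  binomial_sum r
  = q ^ (r * n%:Z ^+ 2)
    * \sum_(k < n) (q ^+ k)^-1 * \prod_(i < k) qcorr i.+1 ^ (2 * r).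
Proof.
rewrite mulr_sumr; apply: eq_bigr => k _; rewrite summandE // expfzDr //.
by rewrite -exprnN mulrA.
Qed.

End Summand.

Lemma binomial_sum1 (F : fieldType) (q : F) (r : int) : 1 - q != 0 ->
  binomial_sum q 1 r = binomial_sum_value q 1 r.
Proof.
move=> q1; rewrite /binomial_sum /binomial_sum_value big_ord1 /qint /qbinom /=.
rewrite /qpoch !big_ord0 !big_ord1 expr0 mulr1 expr1 !mul1r !divff ?oner_neq0 //.
rewrite !exp1rz !mulr1.
have -> : r * (2 * r - 1) * (1%:Z - 1) ^+ 2 = 0 by ring.
rewrite mulr0z !mul0r subr0.
by rewrite invr1 exp1rz mulr1; congr (q ^ _); ring.
Qed.

(** * Congruences in a subring of a field *)

Section Congruence.

Variables (F : fieldType) (S : subringClosed F).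

(** Congruence modulo the ideal m S, for m nonzero.  Dividing by m inside the
    field keeps the quotient out of the statements. *)
Definition cong_mod (m x y : F) : Prop := (x - y) / m \in S.

Definition unit_in (x : F) : bool := [&& x != 0, x \in S & x^-1 \in S].

Lemma cong_refl m x : cong_mod m x x.
Proof. by rewrite /cong_mod subrr mul0r rpred0. Qed.

Lemma cong_sym m x y : cong_mod m x y -> cong_mod m y x.
Proof. by rewrite /cong_mod => xy; rewrite -opprB mulNr rpredN. Qed.

Lemma cong_trans m y x z : cong_mod m x y -> cong_mod m y z -> cong_mod m x z.
Proof.
rewrite /cong_mod => xy yz.
have -> : x - z = (x - y) + (y - z) by ring.
by rewrite mulrDl rpredD.
Qed.

Lemma congD m x y x' y' :
  cong_mod m x y -> cong_mod m x' y' -> cong_mod m (x + x') (y + y').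
Proof.
rewrite /cong_mod => xy xy'.
by rewrite opprD addrACA mulrDl rpredD.
Qed.

Lemma congN m x y : cong_mod m x y -> cong_mod m (- x) (- y).
Proof.
rewrite /cong_mod => xy.
by rewrite -opprD mulNr rpredN.
Qed.

Lemma congB m x y x' y' :
  cong_mod m x y -> cong_mod m x' y' -> cong_mod m (x - x') (y - y').
Proof. by move=> xy xy'; apply/congD/congN. Qed.

Lemma congM m x y x' y' : x' \in S -> y \in S ->
  cong_mod m x y -> cong_mod m x' y' -> cong_mod m (x * x') (y * y').
Proof.
rewrite /cong_mod => x'S yS xy xy'.
rewrite (_ : _ / m = x' * ((x - y) / m) + y * ((x' - y') / m)); last by ring.
by apply: rpredD => //; apply: rpredM.
Qed.

Lemma congMl m c x y : c \in S -> cong_mod m x y -> cong_mod m (c * x) (c * y).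
Proof. by rewrite /cong_mod => cS xy; rewrite -mulrBr -mulrA rpredM. Qed.

Lemma cong_sum m (I : Type) (s : seq I) (P : pred I) (f g : I -> F) :
  (forall i, P i -> cong_mod m (f i) (g i)) ->
  cong_mod m (\sum_(i <- s | P i) f i) (\sum_(i <- s | P i) g i).
Proof.
by move=> fg; rewrite /cong_mod -sumrB mulr_suml rpred_sum.
Qed.

Lemma cong_scale c m x y : c != 0 ->
  cong_mod m x y -> cong_mod (c * m) (c * x) (c * y).
Proof.
rewrite /cong_mod => c0; rewrite -mulrBr invfM mulrACA mulfV //.
by rewrite mul1r.
Qed.

Lemma cong_weaken c m x y : c != 0 -> c \in S ->
  cong_mod (c * m) x y -> cong_mod m x y.
Proof.
rewrite /cong_mod => c0 cS /(rpredM cS); congr (_ \in S).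
by rewrite invfM mulrCA mulVKf.
Qed.

Lemma cong_in m x y : m != 0 -> m \in S -> cong_mod m x y -> y \in S -> x \in S.
Proof.
rewrite /cong_mod => m0 mS xy yS.
have -> : x = (x - y) / m * m + y by rewrite divfK // subrK.
by apply: rpredD => //; apply: rpredM.
Qed.

Lemma unit_in_neq0 x : unit_in x -> x != 0. Proof. by case/and3P. Qed.
Lemma unit_in_mem x : unit_in x -> x \in S. Proof. by case/and3P. Qed.
Lemma unit_in_V x : unit_in x -> x^-1 \in S. Proof. by case/and3P. Qed.

Lemma unit_inM x y : unit_in x -> unit_in y -> unit_in (x * y).
Proof.
case/and3P=> x0 xS xV /and3P[y0 yS yV].
by rewrite /unit_in mulf_neq0 // invfM !rpredM.
Qed.

Lemma unit_inV x : unit_in x -> unit_in x^-1.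
Proof. by case/and3P=> x0 xS xV; rewrite /unit_in invr_neq0 ?invrK ?xS ?xV. Qed.

Lemma unit_inN x : unit_in x -> unit_in (- x).
Proof. by case/and3P=> x0 xS xV; rewrite /unit_in oppr_eq0 invrN !rpredN x0 xS. Qed.

Lemma unit_inX x m : unit_in x -> unit_in (x ^+ m).
Proof.
by case/and3P=> x0 xS xV; rewrite /unit_in expf_neq0 // -exprVn !rpredX.
Qed.

Lemma unit_in_expz x (m : int) : unit_in x -> unit_in (x ^ m).
Proof. by case: m => m xu; [|apply: unit_inV]; apply: unit_inX. Qed.

Hypothesis nat_unit : forall m, unit_in m.+1%:R.

(** Binomial series to second order for an exponent of either sign: the
    truncations p(m) satisfy p(m+1) = (1 + e) p(m) up to a multiple of e^3, so the
    congruence propagates from m = 0 in both directions. *)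
Lemma expz_expansion e (m : int) : e != 0 -> e \in S -> unit_in (1 + e) ->
  cong_mod (e ^+ 3) ((1 + e) ^ m) (1 + m%:~R * e + (m * (m - 1))%:~R / 2 * e ^+ 2).
Proof.
move=> e0 eS eu.
have two0 : (2 : F) != 0 by apply: unit_in_neq0 (nat_unit 1).
have halfS : (2 : F)^-1 \in S by apply: unit_in_V (nat_unit 1).
have [e1 _ eV] := and3P eu.
pose p (m : int) := 1 + m%:~R * e + (m * (m - 1))%:~R / 2 * e ^+ 2.
have pS k : p (k + 1) - (1 + e) * p k = - ((k * (k - 1))%:~R / 2 * e ^+ 3).
  by rewrite /p; field.
have cS (k : int) : (k * (k - 1))%:~R / 2 \in S by rewrite rpredM ?rpred_int.
have step k : cong_mod (e ^+ 3) ((1 + e) ^ k) (p k) <->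
              cong_mod (e ^+ 3) ((1 + e) ^ (k + 1)) (p (k + 1)).
  rewrite /cong_mod expfzDr // expr1z; split => H.
    rewrite (_ : _ / _ = (1 + e) * (((1 + e) ^ k - p k) / e ^+ 3)
              - (p (k + 1) - (1 + e) * p k) / e ^+ 3); last by field.
    by rewrite pS mulNr opprK mulfK ?expf_neq0 // rpredD // rpredM // unit_in_mem.
  rewrite (_ : _ / _ = (1 + e)^-1 * (((1 + e) ^ k * (1 + e) - p (k + 1)) / e ^+ 3
              + (p (k + 1) - (1 + e) * p k) / e ^+ 3)); last by field; apply/andP.
  by rewrite pS mulNr mulfK ?expf_neq0 // rpredM // rpredB.
rewrite -/(p m).
have base : cong_mod (e ^+ 3) ((1 + e) ^ 0) (p 0).
  by rewrite (_ : p 0 = 1) ?expr0z; [exact: cong_refl | rewrite /p; field].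
elim/int_ind: m => // k IHk.
  have -> : k.+1%:Z = k%:Z + 1 by ring.
  exact: (proj1 (step k)).
apply: (proj2 (step (- k.+1%:Z))).
by have -> : - k.+1%:Z + 1 = - k%:Z by ring.
Qed.

(** To first order in e, a product of factors near 1 is 1 plus the sum of their
    deviations. *)
Lemma prod_cong_sum e (I : Type) (s : seq I) (f a : I -> F) :
  e != 0 -> e \in S -> (forall i, a i \in S) ->
  (forall i, cong_mod (e ^+ 2) (f i) (1 + e * a i)) ->
  cong_mod (e ^+ 2) (\prod_(i <- s) f i) (1 + e * \sum_(i <- s) a i).
Proof.
move=> e0 eS aS fa; elim: s => [|i s IHs].
  by rewrite !big_nil mulr0 addr0; apply: cong_refl.
rewrite !big_cons.
have sS : 1 + e * \sum_(j <- s) a j \in S.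
  by rewrite rpredD ?rpred1 // rpredM ?rpred_sum.
have pS : \prod_(j <- s) f j \in S.
  by apply: cong_in IHs sS; rewrite ?expf_neq0 ?rpredX.
apply: (cong_trans (y := (1 + e * a i) * (1 + e * \sum_(j <- s) a j))).
  by apply: congM => //; rewrite rpredD ?rpred1 // rpredM.
rewrite /cong_mod (_ : _ / _ = a i * \sum_(j <- s) a j) ?rpredM ?rpred_sum //.
by field.
Qed.

End Congruence.

(** * Congruence modulo the fourth power of 1 - q^n *)

Section TopCyclotomicFactor.

Variables (F : fieldType) (S : subringClosed F) (q : F) (N : nat).

Let n := N.+1.
Let t : F := 1 - q ^+ n.

Hypothesis N_gt0 : (0 < N)%N.
Hypothesis nat_unit : forall m, unit_in S m.+1%:R.
Hypothesis q_unit : unit_in S q.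
Hypothesis qpow_neq1 : forall i, (0 < i)%N -> 1 - q ^+ i != 0.
Hypothesis qint_unit : forall j, (0 < j < n)%N -> unit_in S (1 - q ^+ j).
(* A Jacobson radical condition: it makes the correction factors invertible. *)
Hypothesis t_radical : forall y, y \in S -> unit_in S (1 + t * y).

Let q0 : q != 0 := unit_in_neq0 q_unit.
Let qS : q \in S := unit_in_mem q_unit.
Let t0 : t != 0 := qpow_neq1 (ltn0Sn N).

Let tS : t \in S.
Proof. by rewrite /t rpredB ?rpred1 ?rpredX. Qed.

Let qjS (i : 'I_N) : unit_in S (1 - q ^+ i.+1).
Proof. by apply: qint_unit; rewrite /= ltnS. Qed.

Let nat_neq0 m : m.+1%:R != 0 :> F. Proof. exact: unit_in_neq0 (nat_unit m). Qed.

Let nat_inv m : (m.+1%:R : F)^-1 \in S.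
Proof. exact: unit_in_V (nat_unit m). Qed.

Lemma qweight_in (i : 'I_N) : qweight q i.+1 \in S.
Proof. by rewrite rpredM ?rpredX // -exprVn rpredX ?unit_in_V. Qed.

Lemma qpow_mul_cong1 j : cong_mod S t (q ^+ (n * j)) 1.
Proof.
rewrite /cong_mod -opprB mulNr rpredN exprM.
have -> : 1 - (q ^+ n) ^+ j = t * \sum_(i < j) (q ^+ n) ^+ i.
  by rewrite -[LHS]opprB subrX1 -mulNr opprB.
by rewrite mulrC mulKf // rpred_sum // => i _; rewrite !rpredX.
Qed.

Let W : F := \sum_(i < N) qweight q i.+1.
Let H : F := \sum_(i < N) (1 - q ^+ i.+1)^-1.
Let V : F := \sum_(i < N) ((1 - q ^+ i.+1) ^+ 2)^-1.

Let W_in : W \in S. Proof. by rewrite rpred_sum // => i _; rewrite qweight_in. Qed.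

(** Adding the missing term j = 0 completes a full geometric series, whose sum is
    a multiple of 1 - q^(n i). *)
Lemma sum_qpow_reduced i : (0 < i < n)%N ->
  cong_mod S t (\sum_(j < N) q ^+ (j.+1 * i)) (- 1).
Proof.
move=> lt_in; have iu := qint_unit lt_in.
have E : (1 - q ^+ i) * (\sum_(j < N) q ^+ (j.+1 * i) + 1) = 1 - q ^+ (n * i).
  have -> : \sum_(j < N) q ^+ (j.+1 * i) + 1 = \sum_(j < n) (q ^+ i) ^+ j.
    rewrite big_ord_recl expr0 addrC; congr (_ + _).
    by apply: eq_bigr => j _; rewrite -exprM mulnC.
  by rewrite mulnC exprM -[RHS]opprB subrX1 -mulNr opprB.
rewrite /cong_mod opprK.
have -> : (\sum_(j < N) q ^+ (j.+1 * i) + 1) / t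
        = (1 - q ^+ i)^-1 * ((1 - q ^+ (n * i)) / t).
  by rewrite -E; field; rewrite t0 (unit_in_neq0 iu).
by rewrite rpredM ?unit_in_V //; apply/cong_sym/qpow_mul_cong1.
Qed.

(** Discrete Fourier expansion of the weight: for z^n = 1 and z different from 1,
    2 n z / (1 - z)^2 = \sum_(i < n) i (n - i) z^i. *)
Lemma qweight_expansion (j : 'I_N) :
  cong_mod S t (2 * n%:R * qweight q j.+1)
    (\sum_(i < n) i%:R * (n%:R - i%:R) * q ^+ (j.+1 * i)).
Proof.
set z := q ^+ j.+1; have zu : unit_in S (1 - z) by exact: qjS.
have z1 := unit_in_neq0 zu.
have -> : \sum_(i < n) i%:R * (n%:R - i%:R) * q ^+ (j.+1 * i)
   = \sum_(i < n) i%:R * (n%:R - i%:R) * z ^+ i.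
  by apply: eq_bigr => i _; rewrite exprM.
rewrite /cong_mod.
have -> : (2 * n%:R * qweight q j.+1
           - \sum_(i < n) i%:R * (n%:R - i%:R) * z ^+ i) / t
  = (1 - z)^-1 ^+ 3 * ((n%:R + 1) * z - (n%:R - 1) * z ^+ 2)
    * ((1 - z ^+ n) / t).
  apply: (mulfI (expf_neq0 3 z1)); rewrite mulrA mulrBr.
  rewrite quadratic_power_sum /qweight -/z !exprS.
  by field; rewrite z1 t0.
rewrite rpredM //; last first.
  by rewrite /z -exprM mulnC; apply/cong_sym/qpow_mul_cong1.
have zS : z \in S by rewrite rpredX.
by rewrite !(rpredB, rpredM, rpredD, rpredX, rpred_nat, rpred1) ?unit_in_V.
Qed.

Lemma quadratic_sum : 6 * \sum_(i < n) i%:R * (n%:R - i%:R) = n%:R ^+ 3 - n%:R :> F.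
Proof.
have closed k : 6 * \sum_(i < k) i%:R * (n%:R - i%:R)
         = k%:R * (k%:R - 1) * (3 * n%:R - 2 * k%:R + 1) :> F.
  elim: k => [|k IHk]; first by rewrite big_ord0; ring.
  by rewrite big_ord_recr /= mulrDr IHk -[k.+1%:R]natr1; ring.
by rewrite closed; ring.
Qed.

(** In the Fourier expansion every nontrivial power sum is - 1, so that only
    - \sum_i i (n - i) / (2 n) is left. *)
Lemma qweight_sum_cong : cong_mod S t W (- (n%:R ^+ 2 - 1) / 12).
Proof.
have E : cong_mod S t (2 * n%:R * W) (- \sum_(i < n) i%:R * (n%:R - i%:R)).
  rewrite /W mulr_sumr; apply: cong_trans.
    by apply: cong_sum => j _; exact: qweight_expansion.
  rewrite exchange_big -sumrN /=; apply: cong_sum => i _.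
  rewrite -mulr_sumr -[X in cong_mod _ _ _ X]mulrN1.
  have [->|i0] := posnP i; first by rewrite mulr0n !mul0r; apply: cong_refl.
  apply: congMl; last by apply: sum_qpow_reduced; rewrite i0 /=.
  by rewrite rpredM ?rpredB ?rpred_nat.
have /(congMl (_ : (2 * n%:R)^-1 \in S)) := E.
have -> : (2 * n%:R)^-1 * (2 * n%:R * W) = W.
  by rewrite mulKf // mulf_neq0 ?nat_neq0.
have -> : (2 * n%:R)^-1 * - (\sum_(i < n) i%:R * (n%:R - i%:R))
        = - (n%:R ^+ 2 - 1) / 12 :> F.
  have := quadratic_sum; set s := \sum_(i < n) _ => Es.
  have s6 : s = (n%:R ^+ 3 - n%:R) / 6.
    by rewrite -Es mulrC mulKf // nat_neq0.
  rewrite s6; field.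
  by rewrite !nat_neq0.
apply; rewrite invfM rpredM ?nat_inv //.
Qed.

(** Pairing j with n - j: the two reciprocals add up to
    1 + t / ((1 - q^j) (1 - q^(n-j))), and q^(n-j) is q^(-j) modulo t. *)
Lemma qharmonic_sum_cong : cong_mod S (t ^+ 2) (2 * H) (N%:R - t * W).
Proof.
have Hrev : H = \sum_(i < N) (1 - q ^+ (n - i.+1))^-1.
  rewrite /H (reindex_inj rev_ord_inj) /=; apply: eq_bigr => i _.
  by congr (1 - q ^+ _)^-1; have := ltn_ord i; rewrite /n; lia.
have -> : 2 * H = \sum_(i < N) ((1 - q ^+ i.+1)^-1 + (1 - q ^+ (n - i.+1))^-1).
  by rewrite big_split /= -Hrev -/H; ring.
have -> : N%:R - t * W = \sum_(i < N) (1 - t * qweight q i.+1).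
  by rewrite sumrB sumr_const card_ord mulr_sumr.
apply: cong_sum => i _; rewrite /cong_mod.
have iu := qjS i.
have iu' : unit_in S (1 - q ^+ (n - i.+1)).
  by apply: qint_unit; have := ltn_ord i; rewrite /n; lia.
have nE : q ^+ n = q ^+ (n - i.+1) * q ^+ i.+1.
  by rewrite -exprD subnK // ltnS ltnW.
rewrite (_ : _ / _ = (1 - q ^+ (n - i.+1))^-1 * ((1 - q ^+ i.+1)^-1) ^+ 2).
  by rewrite rpredM ?rpredX ?unit_in_V.
have := t0; rewrite /qweight /t nE.
move: (unit_in_neq0 iu) (unit_in_neq0 iu') => x1 y1 xy1.
by field; rewrite x1 y1 xy1.
Qed.

(** The sum left by Abel summation equals - H + t V with V = W + H; it
    therefore needs H modulo t^2 but W only modulo t. *)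
Lemma abel_weight_sum_cong :
  cong_mod S (t ^+ 2) (W - q ^+ n * V)
    (- (N%:R / 2) - t * (N%:R * (N%:R - 2) / 8)).
Proof.
have two0 := nat_neq0 1.
have WV : V = W + H.
  rewrite -big_split /=; apply: eq_bigr => i _; rewrite /qweight.
  by have := unit_in_neq0 (qjS i) => x1; field.
have -> : W - q ^+ n * V = - H + t * (W + H) by rewrite WV /t; ring.
have Hhalf : cong_mod S (t ^+ 2) H (2^-1 * (N%:R - t * W)).
  rewrite -[H](mulKf two0); apply: congMl; first exact: nat_inv 1.
  exact: qharmonic_sum_cong.
have Ht : cong_mod S t H (N%:R / 2).
  apply: (@cong_trans _ _ _ (2^-1 * (N%:R - t * W))).
    by apply: (cong_weaken t0) => //; rewrite -expr2.
  rewrite /cong_mod (_ : _ / t = - (2^-1 * W)); last by field; rewrite two0 t0.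
  by rewrite rpredN rpredM // (nat_inv 1).
have Wt := qweight_sum_cong.
have step : cong_mod S (t ^+ 2) (- H + t * (W + H))
   (- (N%:R / 2) + t * (3 / 2 * W + N%:R / 2)).
  have -> : - (N%:R / 2) + t * (3 / 2 * W + N%:R / 2)
          = - (2^-1 * (N%:R - t * W)) + t * (W + N%:R / 2) by field.
  apply: congD; first exact: congN.
  by apply: cong_scale => //; apply: congD; [apply: cong_refl|].
apply: cong_trans step _.
have -> : - (N%:R / 2) - t * (N%:R * (N%:R - 2) / 8)
   = - (N%:R / 2) + t * (3 / 2 * (- (n%:R ^+ 2 - 1) / 12) + N%:R / 2) :> F.
  by rewrite /n -natr1; field; rewrite !nat_neq0.
apply: congD; first exact: cong_refl.
rewrite expr2; apply: cong_scale => //; apply: congD; last exact: cong_refl.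
by apply: congMl => //; rewrite rpredM ?rpred_nat ?(nat_inv 1).
Qed.

(** The deviation of u_j from 1 is of order t^2, hence the linear term of the
    binomial series suffices modulo t^4. *)
Lemma qcorr_pow (r : int) (i : 'I_N) :
  cong_mod S (t ^+ 2 ^+ 2) (qcorr q n i.+1 ^ (2 * r))
    (1 + t ^+ 2 * (- (2 * r)%:~R / q ^+ n * qweight q i.+1)).
Proof.
set w := qweight q i.+1; pose c := - (w / q ^+ n).
have two0 := nat_neq0 1.
have wS : w \in S := qweight_in i.
have qnV : (q ^+ n)^-1 \in S by rewrite -exprVn rpredX ?unit_in_V.
have cS : c \in S by rewrite rpredN rpredM.
have c0 : c != 0.
  rewrite oppr_eq0 !mulf_neq0 ?invr_eq0 ?expf_neq0 //.
  exact: unit_in_neq0 (qjS i).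
have eE : qcorr q n i.+1 = 1 + t ^+ 2 * c.
  by rewrite /qcorr -/w -/t /c; field; rewrite expf_neq0.
have t20 : t ^+ 2 * c != 0 by rewrite mulf_neq0 ?expf_neq0.
have t2S : t ^+ 2 * c \in S by rewrite rpredM ?rpredX.
have eu : unit_in S (1 + t ^+ 2 * c).
  by rewrite -mulrA; apply: t_radical; rewrite rpredM.
have := expz_expansion nat_unit (2 * r) t20 t2S eu; rewrite -eE.
(* The remainder e^3 of the binomial series has order t^6. *)
rewrite (_ : (t ^+ 2 * c) ^+ 3 = (t ^+ 2 * c ^+ 3) * t ^+ 2 ^+ 2); last by ring.
move/(cong_weaken _ _) => E; apply: cong_trans (E _ _) _.
- by rewrite mulf_neq0 ?expf_neq0.
- by rewrite rpredM ?rpredX.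
rewrite /cong_mod.
have -> : 1 + (2 * r)%:~R * (t ^+ 2 * c)
    + (2 * r * (2 * r - 1))%:~R / 2 * (t ^+ 2 * c) ^+ 2
    - (1 + t ^+ 2 * (- (2 * r)%:~R / q ^+ n * w))
  = (2 * r * (2 * r - 1))%:~R / 2 * c ^+ 2 * t ^+ 2 ^+ 2.
  by rewrite /c; field; rewrite two0 expf_neq0.
by rewrite mulfK ?expf_neq0 // !rpredM ?rpredX ?rpred_int ?(nat_inv 1).
Qed.

Lemma binomial_sum_expansion r :
  cong_mod S (t ^+ 2 ^+ 2)
   (\sum_(k < n) (q ^+ k)^-1 * \prod_(i < k) qcorr q n i.+1 ^ (2 * r))
   ((t - (2 * r)%:~R * t ^+ 2 / q ^+ n
      * (- (N%:R / 2) - t * (N%:R * (N%:R - 2) / 8))) / ((1 - q) * q ^+ N)).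
Proof.
have q1u : unit_in S (1 - q) by apply: (@qint_unit 1).
have q10 := unit_in_neq0 q1u.
have qV : q^-1 \in S by exact: unit_in_V.
have qN0 m : q ^+ m != 0 by rewrite expf_neq0.
have qVX m : (q ^+ m)^-1 \in S by rewrite -exprVn rpredX.
pose a := - (2 * r)%:~R / q ^+ n.
have aS : a \in S by rewrite rpredM ?rpredN ?rpred_int.
apply: (@cong_trans _ _ _ (\sum_(k < n) (q ^+ k)^-1
          * (1 + t ^+ 2 * \sum_(i < k) a * qweight q i.+1))).
  apply: cong_sum => k _; apply: congMl => //.
  have lt_iN (i : 'I_k) : (i < N)%N.
    by have := ltn_ord k; have := ltn_ord i; rewrite /n; lia.
  apply: prod_cong_sum => [||i|i]; rewrite ?expf_neq0 ?rpredX //.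
    by rewrite rpredM // (qweight_in (Ordinal (lt_iN i))).
  exact: (qcorr_pow r (Ordinal (lt_iN i))).
pose D := \sum_(k < n) (q ^+ k)^-1 * \sum_(i < k) qweight q i.+1.
have DE : (1 - q) * q ^+ N * D = W - q ^+ n * V by exact: abel_weight_sum.
have GE : (1 - q) * q ^+ N * \sum_(k < n) (q ^+ k)^-1 = t.
  exact: geometric_inv_sum.
have -> : \sum_(k < n) (q ^+ k)^-1
            * (1 + t ^+ 2 * \sum_(i < k) a * qweight q i.+1)
   = \sum_(k < n) (q ^+ k)^-1 + t ^+ 2 * a * D.
  rewrite /D mulr_sumr -big_split /=; apply: eq_bigr => k _.
  by rewrite -mulr_sumr; ring.
have -> : \sum_(k < n) (q ^+ k)^-1 + t ^+ 2 * a * D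
   = ((1 - q) * q ^+ N)^-1 * (t + t ^+ 2 * a * (W - q ^+ n * V)).
  by rewrite -DE -GE; field; rewrite qN0 q10.
rewrite [X in cong_mod _ _ _ X]mulrC; apply: congMl.
  by rewrite invfM rpredM // unit_in_V.
apply: congD; first exact: cong_refl.
have -> : - ((2 * r)%:~R * t ^+ 2 / q ^+ n
             * (- (N%:R / 2) - t * (N%:R * (N%:R - 2) / 8)))
   = t ^+ 2 * (a * (- (N%:R / 2) - t * (N%:R * (N%:R - 2) / 8))).
  by rewrite /a; field; rewrite !nat_neq0 qN0.
rewrite -mulrA expr2; apply: cong_scale; first by rewrite expf_neq0.
by apply: congMl => //; exact: abel_weight_sum_cong.
Qed.

(** After removing the common factor q t / (1 - q), both sides are polynomials in
    t and powers of q^n = 1 - t, to be compared modulo t^3. *)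
Lemma binomial_sum_top_factor r :
  cong_mod S (t ^+ 4) (binomial_sum q n r) (binomial_sum_value q n r).
Proof.
have q1u : unit_in S (1 - q) by apply: (@qint_unit 1).
have q10 := unit_in_neq0 q1u.
have qN0 m : q ^+ m != 0 by rewrite expf_neq0.
have qVX m : (q ^+ m)^-1 \in S by rewrite -exprVn rpredX ?unit_in_V.
rewrite binomial_sumE //.
apply: cong_trans.
  apply: congMl; first by apply/unit_in_mem/unit_in_expz.
  have -> : t ^+ 4 = t ^+ 2 ^+ 2 by ring.
  exact: binomial_sum_expansion.
pose d := - (N%:R / 2) - t * (N%:R * (N%:R - 2) / 8) : F.
have qnt : q ^+ n = 1 - t by rewrite /t; ring.
pose A (m : int) := (1 - t) ^ m.
have AS m : A m \in S by rewrite /A -qnt; apply/unit_in_mem/unit_in_expz/unit_inX.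
have AE m : cong_mod S (t ^+ 3) (A m)
              (1 - m%:~R * t + (m * (m - 1))%:~R / 2 * t ^+ 2).
  have := @expz_expansion _ S nat_unit (- t) m.
  rewrite oppr_eq0 rpredN => /(_ t0 tS) E.
  have {}E : cong_mod S ((- t) ^+ 3) (A m)
     (1 + m%:~R * - t + (m * (m - 1))%:~R / 2 * (- t) ^+ 2).
    by apply: E; rewrite -qnt unit_inX.
  move: E; rewrite sqrrN mulrN /cong_mod.
  by rewrite (_ : (- t) ^+ 3 = - t ^+ 3) ?invrN ?mulrN ?rpredN //; ring.
have AS1 (m : int) : A (m + 1) = A m * (1 - t) by rewrite /A expfzDr // -qnt.
have lhsE : q ^ (r * n%:Z ^+ 2)
    * ((t - (2 * r)%:~R * t ^+ 2 / q ^+ n * d) / ((1 - q) * q ^+ N))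
  = q / (1 - q)
    * (t * (A (r * n%:Z - 1) - (2 * r)%:~R * (t * (A (r * n%:Z - 2) * d)))).
  have -> : q ^ (r * n%:Z ^+ 2) = A (r * n%:Z - 2) * q ^+ n * (q ^+ N * q).
    rewrite /A -qnt -[q ^+ n]/(q ^ n%:Z) -[q ^+ N]/(q ^ N%:Z) exprz_exp.
    rewrite -[X in _ = _ * (_ * X)](expr1z q) -!expfzDr //.
    by congr (q ^ _); rewrite /n; ring.
  have -> : r * n%:Z - 1 = r * n%:Z - 2 + 1 by ring.
  by rewrite AS1 -qnt; field; rewrite !qN0 q10.
have rhsE : binomial_sum_value q n r
  = q / (1 - q) * (t * (A (r - 1)
       - (r * (2 * r - 1))%:~R * N%:R ^+ 2 / 4 * t ^+ 2)).
  rewrite /binomial_sum_value.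
  have -> : q ^ ((r - 1) * n%:Z + 1) = A (r - 1) * q.
    rewrite /A -qnt -[q ^+ n]/(q ^ n%:Z) exprz_exp expfzDr // expr1z.
    by rewrite [_ * n%:Z]mulrC.
  have -> : n%:Z - 1 = N%:Z by rewrite /n; ring.
  rewrite /qint -/t; field.
  by rewrite q10 (nat_neq0 3).
rewrite lhsE rhsE; apply: congMl; first by rewrite rpredM ?unit_in_V.
rewrite (exprS t 3); apply: cong_scale => //.
have two0 := nat_neq0 1.
have natS m : m%:R \in S by rewrite rpred_nat.
have halfS : (2 : F)^-1 \in S := nat_inv 1.
have dS : d \in S.
  by rewrite !(tS, rpredB, rpredM, rpredN, natS, halfS, nat_inv 7).
set m1 := r * n%:Z - 1; set m2 := r * n%:Z - 2.
pose p (m : int) : F := 1 - m%:~R * t + (m * (m - 1))%:~R / 2 * t ^+ 2.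
apply: (@cong_trans _ _ _ (p m1 - (2 * r)%:~R * (t * (p m2 * d)))).
  apply: congB; first exact: AE.
  apply: congMl; first by rewrite rpred_int.
  apply: congMl => //; rewrite [A _ * _]mulrC [p _ * _]mulrC.
  by apply: congMl => //; exact: AE.
apply: (@cong_trans _ _ _
  (p (r - 1) - (r * (2 * r - 1))%:~R * N%:R ^+ 2 / 4 * t ^+ 2));
  last by apply: congB; [apply/cong_sym/AE | apply: cong_refl].
(* The quotient of the difference by t^3, collected from the terms that the
   expansion of (1 - t)^m2 times d has beyond the first order. *)
pose d0 : F := - (N%:R / 2); pose d1 : F := - (N%:R * (N%:R - 2) / 8).
pose b : F := (m2 * (m2 - 1))%:~R / 2.
rewrite /cong_mod.
have -> : p m1 - (2 * r)%:~R * (t * (p m2 * d))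
   - (p (r - 1) - (r * (2 * r - 1))%:~R * N%:R ^+ 2 / 4 * t ^+ 2)
   = - (2 * r)%:~R * (b * d0 - m2%:~R * d1 + b * d1 * t) * t ^+ 3.
  rewrite /p /d /b /d0 /d1 /m1 /m2 /n; field.
  by rewrite !nat_neq0.
rewrite mulfK ?expf_neq0 //.
have d0S : d0 \in S by rewrite !(rpredN, rpredM).
have d1S : d1 \in S by rewrite !(rpredB, rpredM, rpredN, natS, nat_inv 7).
have bS : b \in S by rewrite rpredM ?rpred_int.
clearbody b d0 d1.
by rewrite rpredM ?rpredN ?rpred_int // !(rpredD, rpredN) ?rpredM ?rpred_int.
Qed.

End TopCyclotomicFactor.

(** * Congruence modulo the proper cyclotomic factors *)

Section LowerCyclotomicFactor.

Variables (F : fieldType) (S : subringClosed F) (q p : F) (d m : nat).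

Let n := (m * d)%N.
Let t : F := 1 - q ^+ n.

Hypothesis d_gt1 : (1 < d)%N.
Hypothesis m_gt0 : (0 < m)%N.
Hypothesis nat_unit : forall k, unit_in S k.+1%:R.
Hypothesis q_unit : unit_in S q.
Hypothesis qpow_neq1 : forall i, (0 < i)%N -> 1 - q ^+ i != 0.
Hypothesis p_neq0 : p != 0.
Hypothesis p_dvd : (1 - q ^+ d) / p \in S.
Hypothesis coprime_unit : forall j, ~~ (d %| j)%N -> unit_in S (1 - q ^+ j).
Hypothesis quotient_unit :
  forall b, (0 < b)%N -> unit_in S (\sum_(i < b) q ^+ d ^+ i).

Let q0 : q != 0 := unit_in_neq0 q_unit.
Let qS : q \in S := unit_in_mem q_unit.
Let n_gt0 : (0 < n)%N. Proof. by rewrite muln_gt0 m_gt0 ltnW. Qed.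
Let tS : t \in S. Proof. by rewrite rpredB ?rpred1 ?rpredX. Qed.
Let qV_in k : (q ^+ k)^-1 \in S. Proof. by apply/unit_in_V/unit_inX. Qed.

Let oneBqpow_mul b : 1 - q ^+ (b * d) = (1 - q ^+ d) * \sum_(i < b) q ^+ d ^+ i.
Proof. by rewrite mulnC exprM -[LHS]opprB subrX1 -mulNr opprB. Qed.

(** If d divides both exponents, the common factor 1 - q^d cancels and leaves a
    ratio of two geometric sums in q^d; otherwise numerator and denominator are
    units separately. *)
Lemma qint_ratio_unit i j : (0 < i)%N -> (0 < j)%N -> (d %| i)%N = (d %| j)%N ->
  unit_in S ((1 - q ^+ i) / (1 - q ^+ j)).
Proof.
move=> i_gt0 j_gt0 eqd.
have [dj|ndj] := boolP (d %| j)%N; last first.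
  by rewrite unit_inM ?unit_inV ?coprime_unit ?eqd.
have /dvdnP[b jE] := dj; have /dvdnP[a iE] : (d %| i)%N by rewrite eqd.
move: i_gt0 j_gt0; rewrite iE jE !muln_gt0 => /andP[a0 _] /andP[b0 _].
rewrite !oneBqpow_mul invfM mulrACA mulfV ?qpow_neq1 1?ltnW // mul1r.
by rewrite unit_inM ?unit_inV ?quotient_unit.
Qed.

(** Being a unit is needed because the exponent 2 r may be negative.  It holds as
    d divides n + i, n - i and i simultaneously or not at all. *)
Lemma qcorr_unit i : (0 < i < n)%N -> unit_in S (qcorr q n i).
Proof.
case/andP=> i_gt0 lt_in.
have dn : (d %| n)%N by exact: dvdn_mull.
have -> : qcorr q n i = - (q ^+ (n - i))^-1 *
   ((1 - q ^+ (n + i)) / (1 - q ^+ i) * ((1 - q ^+ (n - i)) / (1 - q ^+ i))).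
  have le_in : (0 < i <= n)%N by rewrite i_gt0 ltnW.
  rewrite (qbinom_factorE q0 qpow_neq1 le_in) mulrNN mulKf //.
  exact: expf_neq0.
rewrite unit_inM ?unit_inN ?unit_inV ?unit_inX // unit_inM //.
  by rewrite qint_ratio_unit ?addn_gt0 ?i_gt0 ?orbT ?dvdn_addr.
by rewrite qint_ratio_unit ?subn_gt0 // dvdn_subr // ltnW.
Qed.

Lemma cong_expz1 x (s : int) : unit_in S x -> cong_mod S p x 1 ->
  cong_mod S p (x ^ s) 1.
Proof.
move=> xu x1.
have natpow k : cong_mod S p (x ^+ k) 1.
  elim: k => [|k IHk]; first by rewrite expr0; exact: cong_refl.
  rewrite exprS -[X in cong_mod _ _ _ X]mulr1; apply: congM => //.
    exact/unit_in_mem/unit_inX.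
  exact: rpred1.
case: s => k; first exact: natpow.
have yu : unit_in S (x ^+ k.+1) by exact: unit_inX.
rewrite NegzE -exprnN /cong_mod.
have -> : (x ^- k.+1 - 1) / p = - (x ^+ k.+1)^-1 * ((x ^+ k.+1 - 1) / p).
  by have := unit_in_neq0 yu => y0; field; rewrite y0 p_neq0.
by rewrite rpredM ?rpredN ?unit_in_V //; exact: natpow.
Qed.

Lemma qcorr_pow_cong1 (s : int) i : (i < n)%N -> ~~ (d %| i)%N ->
  cong_mod S p (qcorr q n i ^ s) 1.
Proof.
move=> lt_in ndi.
have i_gt0 : (0 < i)%N by case: (i) ndi; rewrite ?dvdn0.
apply: cong_expz1; first by rewrite qcorr_unit ?i_gt0.
rewrite /cong_mod /qcorr -/t addrC addKr mulNr rpredN.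
have -> : t ^+ 2 / q ^+ n * qweight q i / p
        = t / p * (t / q ^+ n * qweight q i).
  by field; rewrite p_neq0 expf_neq0.
have tp_in : t / p \in S.
  by rewrite /t oneBqpow_mul mulrAC rpredM // unit_in_mem // quotient_unit.
have wS : qweight q i \in S.
  by rewrite rpredM ?rpredX //; apply/unit_in_V/unit_inX/coprime_unit.
by rewrite rpredM // rpredM // rpredM.
Qed.

Let P (s : int) k : F := \prod_(i < k) qcorr q n i.+1 ^ s.

Lemma qcorr_prod_in s k : (k < n)%N -> P s k \in S.
Proof.
move=> lt_kn; apply: rpred_prod => i _; apply/unit_in_mem/unit_in_expz.
by apply: qcorr_unit => /=; apply: leq_ltn_trans lt_kn.
Qed.

(** Inside a block of d consecutive indices only factors u_j with d not dividing j
    are added, and those are 1 modulo p. *)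
Lemma qcorr_prod_block s a b : (b < d)%N -> (b + a * d < n)%N ->
  cong_mod S p (P s (b + a * d)) (P s (a * d)).
Proof.
elim: b => [|b IHb] lt_bd lt_n; first by exact: cong_refl.
rewrite addSn /P big_ord_recr -[X in cong_mod _ _ _ X]mulr1 /=.
apply: congM.
- by apply/unit_in_mem/unit_in_expz/qcorr_unit.
- by apply: qcorr_prod_in; apply: leq_ltn_trans lt_n; rewrite leq_addl.
- by apply: IHb; apply: ltnW.
- apply: qcorr_pow_cong1 => //.
  by rewrite -addSn dvdn_addl ?dvdn_mull // gtnNdvd.
Qed.

Lemma sum_blocks (f : nat -> F) :
  \sum_(k < n) f k = \sum_(a < m) \sum_(b < d) f (b + a * d)%N.
Proof.
rewrite -(big_mkord xpredT f) /n big_nat_mul big_mkord; apply: eq_bigr => a _.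
by rewrite -{1}[(a * d)%N]add0n big_addn mulSn addnK big_mkord.
Qed.

(** On each block the product is constant modulo p, and the remaining geometric
    series over d consecutive powers of q has the factor 1 - q^d. *)
Lemma binomial_sum_lower_factor r : cong_mod S p (binomial_sum q n r) 0.
Proof.
rewrite binomial_sumE // -[X in cong_mod _ _ _ X](mulr0 (q ^ (r * n%:Z ^+ 2))).
apply: congMl; first exact/unit_in_mem/unit_in_expz.
have -> := sum_blocks (fun k => (q ^+ k)^-1 * P (2 * r) k).
apply: (@cong_trans _ _ _ (\sum_(a < m) 0)); last first.
  by rewrite big1_eq; exact: cong_refl.
apply: cong_sum => a _.
have lt_blk (b : 'I_d) : (b + a * d < n)%N.
  apply: (@leq_trans (a.+1 * d)%N); first by rewrite mulSn ltn_add2r.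
  by rewrite leq_mul2r ltn_ord orbT.
have lt_ad : (a * d < n)%N.
  by rewrite ltn_mul2r ltn_ord ltnW.
apply: (@cong_trans _ _ _ (\sum_(b < d) (q ^+ (b + a * d))^-1 * P (2 * r) (a * d))).
  by apply: cong_sum => b _; apply: congMl => //; exact: qcorr_prod_block.
have q1u : unit_in S (1 - q).
  by rewrite -[q]expr1; apply: coprime_unit; rewrite gtnNdvd.
have dE : d = d.-1.+1 by rewrite prednK // ltnW.
have := geometric_inv_sum q0 d.-1; rewrite -dE => G.
have -> : \sum_(b < d) (q ^+ (b + a * d))^-1 * P (2 * r) (a * d)
  = (1 - q)^-1 * (q ^+ d.-1)^-1 * (q ^+ (a * d))^-1 * P (2 * r) (a * d)
    * (1 - q ^+ d).
  rewrite -G [RHS]mulrC -mulr_suml.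
  under eq_bigr do rewrite exprD invfM.
  rewrite -mulr_suml; set T := \sum_(i < d) _.
  have := expf_neq0 d.-1 q0; have := expf_neq0 (a * d) q0.
  by move: (unit_in_neq0 q1u) => ? ? ?; field; apply/and3P.
rewrite /cong_mod subr0 -(mulrA _ (1 - q ^+ d)) rpredM // rpredM ?qcorr_prod_in //.
by rewrite rpredM // rpredM // unit_in_V.
Qed.

Lemma binomial_sum_value_lower_factor r :
  cong_mod S p (binomial_sum_value q n r) 0.
Proof.
have q1u : unit_in S (1 - q).
  by rewrite -[q]expr1; apply: coprime_unit; rewrite gtnNdvd.
have qnS : qint q n / p \in S.
  rewrite /qint oneBqpow_mul.
  have -> : (1 - q ^+ d) * (\sum_(i < m) q ^+ d ^+ i) / (1 - q) / p
    = (1 - q ^+ d) / p * (\sum_(i < m) q ^+ d ^+ i) * (1 - q)^-1 by ring.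
  by rewrite rpredM ?unit_in_V // rpredM // unit_in_mem // quotient_unit.
have qnS' : qint q n \in S.
  by rewrite rpredM ?unit_in_V.
have fourV : (4 : F)^-1 \in S := unit_in_V (nat_unit 3).
rewrite /cong_mod subr0.
have -> : binomial_sum_value q n r / p
  = (q ^ ((r - 1) * n%:Z + 1)
     - (r * (2 * r - 1) * (n%:Z - 1) ^+ 2)%:~R * q * (1 - q) ^+ 2 / 4
       * qint q n ^+ 2) * (qint q n / p).
  by rewrite /binomial_sum_value; ring.
rewrite rpredM // rpredB //; first exact/unit_in_mem/unit_in_expz.
have q1S := unit_in_mem q1u.
by rewrite rpredM ?rpredX // rpredM // rpredM ?rpredX // rpredM ?rpred_int.
Qed.

Lemma binomial_sum_cong_lower_factor r :
  cong_mod S p (binomial_sum q n r) (binomial_sum_value q n r).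
Proof.
apply: cong_trans (binomial_sum_lower_factor r) _.
exact/cong_sym/binomial_sum_value_lower_factor.
Qed.

End LowerCyclotomicFactor.

(** * Localizations of a polynomial ring *)

Section Localization.

Variable K : fieldType.
Local Notation L := {fraction {poly K}}.
Local Notation "a %:F" := (tofrac a : L).

Implicit Types (p a b : {poly K}) (x y : L).

(** The localization of K[X] in which the polynomials coprime to p are inverted.
    Testing the reduced denominator makes membership a boolean predicate, to which
    the closure structures of the algebraic hierarchy apply. *)
Definition local_at p : {pred L} :=
  fun x => coprimep (\d_(repr x) %/ gcdp \n_(repr x) \d_(repr x)) p.

Lemma frac_repr x : x = (\n_(repr x))%:F / (\d_(repr x))%:F.
Proof.
have d0 : \d_(repr x) != 0 by exact: denom_ratioP.
apply: (canRL (mulfK _)); first by rewrite tofrac_eq0.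
rewrite -{1}[x]reprK; move: (repr x) d0 => f d0.
unlock tofrac; rewrite -[LHS]FracField.pi_mul.
apply/eqmodP; rewrite /= FracField.equivfE /FracField.mulf.
by rewrite !numden_Ratio ?mulf_neq0 ?oner_eq0 //= !mulr1 mulrC.
Qed.

Lemma frac_lowest_terms x (d := \d_(repr x)) (g := gcdp \n_(repr x) d) :
  [/\ d %/ g != 0, coprimep (\n_(repr x) %/ g) (d %/ g)
    & x = (\n_(repr x) %/ g)%:F / (d %/ g)%:F].
Proof.
have d0 : d != 0 by exact: denom_ratioP.
have g0 : g != 0 by rewrite gcdp_eq0 negb_and d0 orbT.
have dE : d = d %/ g * g by rewrite divpK ?dvdp_gcdr.
have nE : \n_(repr x) = \n_(repr x) %/ g * g by rewrite divpK ?dvdp_gcdl.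
split.
- by apply: contraNneq d0 => dg0; rewrite dE dg0 mul0r.
- by rewrite coprimep_div_gcd // d0 orbT.
rewrite {1}[x]frac_repr -/d {1}dE {1}nE !tofracM invfM mulrACA mulfV ?mulr1 //.
by rewrite tofrac_eq0.
Qed.

Lemma eq_frac a b a' b' : b != 0 -> b' != 0 ->
  a%:F / b%:F = a'%:F / b'%:F -> a * b' = a' * b.
Proof.
move=> b0 b'0 /eqP; rewrite eqr_div ?tofrac_eq0 // -!tofracM tofrac_eq.
by move/eqP.
Qed.

Lemma local_atP p x :
  reflect (exists a b, [/\ b != 0, coprimep b p & x = a%:F / b%:F])
          (x \in local_at p).
Proof.
have [d0 cop xE] := frac_lowest_terms x.
apply: (iffP idP) => [xp|[a [b [b0 bp xE']]]].
  by do 2!eexists; split; [exact: d0 | exact: xp | exact: xE].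
rewrite unfold_in; apply: coprimep_dvdr bp.
move: xE'; rewrite {1}xE => /(eq_frac d0 b0) E.
rewrite coprimep_sym in cop.
by rewrite -(Gauss_dvdpr _ cop) E dvdp_mulIr.
Qed.

Lemma local_at_subring p : subring_closed (local_at p).
Proof.
split=> [|x y /local_atP[a [b [b0 bp ->]]] /local_atP[c [e [e0 ep ->]]]
         |x y /local_atP[a [b [b0 bp ->]]] /local_atP[c [e [e0 ep ->]]]].
- apply/local_atP; exists 1, 1.
  by rewrite oner_neq0 coprime1p divr1 tofrac1.
- apply/local_atP; exists (a * e - c * b), (b * e).
  rewrite mulf_neq0 // coprimepMl bp ep; split=> //.
  by rewrite tofracB !tofracM -mulNr addf_div ?tofrac_eq0 // mulNr.
- apply/local_atP; exists (a * c), (b * e).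
  rewrite mulf_neq0 // coprimepMl bp ep; split=> //.
  by rewrite !tofracM mulf_div.
Qed.

HB.instance Definition _ p :=
  GRing.isSubringClosed.Build L (local_at p) (local_at_subring p).

Lemma local_at_poly p a : a%:F \in local_at p.
Proof.
by apply/local_atP; exists a, 1; rewrite oner_neq0 coprime1p tofrac1 divr1.
Qed.

Lemma coprimep_neq0 p b : size p != 1%N -> coprimep b p -> b != 0.
Proof.
by move=> p1; apply: contraTneq => ->; rewrite coprime0p -size_poly_eq1.
Qed.

Lemma local_at_unit p b : size p != 1%N -> coprimep b p ->
  unit_in (local_at p) b%:F.
Proof.
move=> p1 bp; have b0 := coprimep_neq0 p1 bp.
rewrite /unit_in tofrac_eq0 b0 local_at_poly /=.
by apply/local_atP; exists 1, b; rewrite tofrac1 mul1r.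
Qed.

(** 1 + u a / b = (b + u a) / b, and b + u a is coprime to p when b is and p
    divides u. *)
Lemma local_at_radical p u y : size p != 1%N -> p %| u -> y \in local_at p ->
  unit_in (local_at p) (1 + u%:F * y).
Proof.
move=> p1 /dvdpP[v ->] /local_atP[a [b [b0 bp ->]]].
have -> : 1 + (v * p)%:F * (a%:F / b%:F) = (v * a * p + b)%:F * (b%:F)^-1.
  rewrite tofracD !tofracM mulrDl divff ?tofrac_eq0 // addrC; congr (_ + _).
  by rewrite mulrA (mulrAC _ p%:F).
apply: unit_inM; last exact/unit_inV/local_at_unit.
by apply: local_at_unit => //; rewrite coprimep_sym coprimep_addl_mul coprimep_sym.
Qed.

(** Both conclusions follow from Gauss's lemma applied to the cross-multiplied
    equation; they translate local divisibility back to polynomials. *)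
Lemma local_at_dvd p k a b : b != 0 -> coprimep a b -> p != 0 ->
  a%:F / b%:F / p%:F ^+ k.+1 \in local_at p -> (p ^+ k.+1 %| a) /\ coprimep b p.
Proof.
move=> b0 ab p0 /local_atP[c [e [e0 ep]]].
have pk0 : p ^+ k.+1 != 0 by rewrite expf_neq0.
rewrite -tofracXn -mulrA -invfM -tofracM => /(eq_frac (mulf_neq0 b0 pk0) e0) E.
split.
  rewrite -(Gauss_dvdpl _ (_ : coprimep _ e)).
    by rewrite E mulrA dvdp_mulIr.
  by rewrite coprimep_expl // coprimep_sym.
apply: coprimep_dvdr ep; rewrite -(Gauss_dvdpr _ (_ : coprimep _ a)).
  by rewrite E mulrCA dvdp_mulIl.
by rewrite coprimep_sym.
Qed.

Lemma dvdp_prod_coprime (I : eqType) (s : seq I) (f : I -> {poly K}) a :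
  uniq s -> {in s &, forall i j, i != j -> coprimep (f i) (f j)} ->
  {in s, forall i, f i %| a} -> \prod_(i <- s) f i %| a.
Proof.
elim: s => [|i s IHs] /=; first by rewrite big_nil dvd1p.
case/andP=> nis us cop dvd; rewrite big_cons Gauss_dvdp.
  rewrite dvd ?mem_head // IHs // => [j k js ks|j js].
    by apply: cop; rewrite inE ?js ?ks orbT.
  by apply: dvd; rewrite inE js orbT.
rewrite big_seq; elim/big_ind: _ => [|u v ui vi|j js]; first exact: coprimep1.
  by rewrite coprimepMr ui vi.
apply: cop; rewrite ?inE ?eqxx ?js ?orbT //.
by apply: contraNneq nis => ->.
Qed.

End Localization.

(** * Cyclotomic polynomials over the rationals *)

Definition PhiQ (d : nat) : {poly rat} := pZtoQ 'Phi_d.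

(** Coprimality may be tested over algebraic numbers, where the roots of Phi_d are
    the primitive d-th roots of unity. *)
Lemma coprimep_PhiQ d f : (0 < d)%N ->
  (forall z : algC, d.-primitive_root z -> (map_poly ratr f).[z] != 0) ->
  coprimep f (PhiQ d).
Proof.
move=> d_gt0 fz; have [z0 prz0] := C_prim_root_exists d_gt0.
rewrite coprimep_sym -(coprimep_map (ratr : {rmorphism rat -> algC})).
apply: Pdiv.ClosedField.root_coprimep => z.
rewrite /PhiQ /pZtoQ -map_poly_comp (eq_map_poly (ratr_int _)).
by rewrite (Cintr_Cyclotomic prz0) root_cyclotomic //; exact: fz.
Qed.

Lemma size_PhiQ d : (0 < d)%N -> size (PhiQ d) != 1%N.
Proof.
move=> d_gt0; rewrite /PhiQ /pZtoQ size_map_poly_id0; last first.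
  by rewrite (monicP (Cyclotomic_monic d)) oner_eq0.
by rewrite size_Cyclotomic eqSS -lt0n totient_gt0.
Qed.

Lemma PhiQ_neq0 d : PhiQ d != 0.
Proof.
by rewrite monic_neq0 // /PhiQ /pZtoQ monic_map // Cyclotomic_monic.
Qed.

Lemma prod_PhiQ n : (0 < n)%N -> \prod_(d <- divisors n) PhiQ d = 'X^n - 1.
Proof.
move=> n_gt0; rewrite /PhiQ /pZtoQ -rmorph_prod prod_Cyclotomic //.
by rewrite rmorphB rmorph1 /= map_polyXn.
Qed.

Lemma PhiQ_dvd d n : (0 < n)%N -> (d %| n)%N -> PhiQ d %| 1 - 'X^n.
Proof.
move=> n_gt0 dn; rewrite -opprB -prod_PhiQ // dvdpNr.
by rewrite (big_rem d) -?dvdn_divisors //= dvdp_mulIl.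
Qed.

Lemma map_ratr_one_sub_Xn j (z : algC) : (map_poly ratr (1 - 'X^j)).[z] = 1 - z ^+ j.
Proof. by rewrite rmorphB rmorph1 /= map_polyXn !hornerE. Qed.

Lemma coprimep_one_sub_Xn d j : (0 < d)%N -> ~~ (d %| j)%N ->
  coprimep (1 - 'X^j) (PhiQ d).
Proof.
move=> d_gt0 ndj; apply: coprimep_PhiQ => // z prz.
by rewrite map_ratr_one_sub_Xn subr_eq0 eq_sym -(prim_order_dvd prz).
Qed.

(** At a primitive d-th root of unity the sum takes the value b. *)
Lemma coprimep_geometric d b : (0 < d)%N -> (0 < b)%N ->
  coprimep (\sum_(i < b) 'X^d ^+ i) (PhiQ d).
Proof.
move=> d_gt0 b_gt0; apply: coprimep_PhiQ => // z prz.
rewrite rmorph_sum horner_sum /=.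
under eq_bigr do
  rewrite rmorphXn /= map_polyXn !hornerE (prim_expr_order prz) expr1n.
by rewrite sumr_const card_ord pnatr_eq0 -lt0n.
Qed.

Lemma coprimep_PhiQ_PhiQ d e : (0 < d)%N -> (0 < e)%N -> d != e ->
  coprimep (PhiQ d) (PhiQ e).
Proof.
move=> d_gt0 e_gt0 neq_de; apply: coprimep_PhiQ => // z prz.
have [z0 prz0] := C_prim_root_exists d_gt0.
rewrite /PhiQ /pZtoQ -map_poly_comp (eq_map_poly (ratr_int _)).
rewrite (Cintr_Cyclotomic prz0) -[_ == 0]/(root _ z) root_cyclotomic //.
apply: contraNN neq_de => prz'; rewrite eqn_dvd.
by rewrite (prim_order_dvd prz') (prim_order_dvd prz) !prim_expr_order ?eqxx.
Qed.

Lemma one_sub_qX_powE j : 1 - qX ^+ j = tofrac (1 - 'X^j).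
Proof. by rewrite rmorphB rmorph1 rmorphXn. Qed.

Lemma one_sub_qX_neq0 j : (0 < j)%N -> 1 - qX ^+ j != 0.
Proof.
move=> j_gt0; rewrite one_sub_qX_powE tofrac_eq0 -oppr_eq0 opprB.
by rewrite monic_neq0 // monicXnsubC.
Qed.

Section LocalParameters.

Variable d : nat.
Hypothesis d_gt0 : (0 < d)%N.

Let O := local_at (PhiQ d).

Lemma nat_unit_PhiQ k : unit_in O k.+1%:R.
Proof.
have -> : k.+1%:R = tofrac (k.+1%:R : {poly rat}) by rewrite rmorph_nat.
apply: local_at_unit; first exact: size_PhiQ.
by rewrite -[_%:R]scaler_nat coprimepZl ?pnatr_eq0 // coprime1p.
Qed.

Lemma qX_unit_PhiQ : unit_in O qX.
Proof.
apply: local_at_unit; first exact: size_PhiQ.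
apply: coprimep_PhiQ => // z prz; rewrite map_polyX hornerX.
apply: contra_eq_neq (prim_expr_order prz) => ->.
by rewrite expr0n gtn_eqF // eq_sym oner_eq0.
Qed.

Lemma one_sub_qX_unit_PhiQ j : ~~ (d %| j)%N -> unit_in O (1 - qX ^+ j).
Proof.
move=> ndj; rewrite one_sub_qX_powE; apply: local_at_unit; first exact: size_PhiQ.
exact: coprimep_one_sub_Xn.
Qed.

Lemma geometric_unit_PhiQ b : (0 < b)%N -> unit_in O (\sum_(i < b) qX ^+ d ^+ i).
Proof.
move=> b_gt0.
have -> : \sum_(i < b) qX ^+ d ^+ i = tofrac (\sum_(i < b) 'X^d ^+ i).
  by rewrite rmorph_sum; apply: eq_bigr => i _; rewrite !rmorphXn.
by apply: local_at_unit; [exact: size_PhiQ | exact: coprimep_geometric].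
Qed.

End LocalParameters.

(** Near Phi_n, congruences modulo (1 - q^n)^4 imply congruences modulo Phi_n^4. *)
Lemma binomial_sum_cong_PhiQ n d r : (1 < n)%N -> (1 < d)%N -> (d %| n)%N ->
  cong_mod (local_at (PhiQ d)) (tofrac (PhiQ d) ^+ (if d == n then 4 else 1))
    (binomial_sum qX n r) (binomial_sum_value qX n r).
Proof.
move=> n_gt1 d_gt1 dn; have d_gt0 := ltnW d_gt1; have n_gt0 := ltnW n_gt1.
have Phi0 : tofrac (PhiQ d) != 0 by rewrite tofrac_eq0 PhiQ_neq0.
have dvd_local k : (0 < k)%N -> (d %| k)%N ->
    exists2 v, v \in local_at (PhiQ d) & 1 - qX ^+ k = v * tofrac (PhiQ d).
  move=> k_gt0 /(PhiQ_dvd k_gt0)/dvdpP[v vE]; exists (tofrac v).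
    exact: local_at_poly.
  by rewrite one_sub_qX_powE vE tofracM.
case: eqP => [dE|_]; last first.
  have /dvdnP[m nE] := dn; rewrite nE expr1.
  have m_gt0 : (0 < m)%N by move: n_gt0; rewrite nE muln_gt0 => /andP[].
  have p_dvd : (1 - qX ^+ d) / tofrac (PhiQ d) \in local_at (PhiQ d).
    by have [v vS ->] := dvd_local d d_gt0 (dvdnn d); rewrite mulfK.
  exact: (binomial_sum_cong_lower_factor d_gt1 m_gt0 (nat_unit_PhiQ d_gt0)
    (qX_unit_PhiQ d_gt0) one_sub_qX_neq0 Phi0 p_dvd
    (one_sub_qX_unit_PhiQ d_gt0) (geometric_unit_PhiQ d_gt0)).
have nE : n = n.-1.+1 by rewrite prednK.
have N_gt0 : (0 < n.-1)%N by rewrite -ltnS -nE.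
have := binomial_sum_top_factor (S := local_at (PhiQ d)) (q := qX) N_gt0.
rewrite -nE => top.
have [v vS vE] := dvd_local n n_gt0 dn.
have v0 : v != 0.
  have := one_sub_qX_neq0 n_gt0; rewrite vE; apply: contraNneq => ->.
  by rewrite mul0r.
have t4E : (1 - qX ^+ n) ^+ 4 = v ^+ 4 * tofrac (PhiQ d) ^+ 4 by rewrite vE exprMn.
apply: (@cong_weaken _ _ (v ^+ 4)); rewrite ?expf_neq0 ?rpredX // -t4E.
apply: (top (nat_unit_PhiQ d_gt0) (qX_unit_PhiQ d_gt0) one_sub_qX_neq0).
  move=> j /andP[j_gt0 lt_jn]; apply: one_sub_qX_unit_PhiQ => //.
  by rewrite dE gtnNdvd.
move=> y yS; rewrite one_sub_qX_powE; apply: local_at_radical => //.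
  exact: size_PhiQ.
exact: PhiQ_dvd.
Qed.

(** * Gluing the local congruences *)

(** In (q^n - 1) / (q - 1) the denominator cancels the factor Phi_1 of the
    cyclotomic factorization of the numerator. *)
Lemma qint_prod_PhiQ n : (0 < n)%N ->
  qint qX n = tofrac (\prod_(d <- divisors n | d != 1%N) PhiQ d).
Proof.
move=> n_gt0.
have n1 : 1%N \in divisors n by rewrite -dvdn_divisors ?dvd1n.
have := prod_PhiQ n_gt0; rewrite (bigD1_seq 1%N) ?divisors_uniq //=.
have -> : PhiQ 1 = 'X^1 - 1 by rewrite -prod_PhiQ // big_seq1.
move=> E; apply: (canLR (mulfK _)); first exact: (@one_sub_qX_neq0 1).
rewrite one_sub_qX_powE (one_sub_qX_powE 1) -tofracM; congr tofrac.
by rewrite -[LHS]opprB -E -mulNr opprB mulrC.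
Qed.

(** Numerator and denominator over Q become integral after clearing denominators;
    nonzero constants affect neither divisibility nor coprimality. *)
Lemma Qq_congr_of_fraction (P : {poly int}) (x y : Qq) (a b : {poly rat}) :
  b != 0 -> x - y = tofrac a / tofrac b -> pZtoQ P %| a ->
  coprimep b (pZtoQ P) -> Qq_congr (pZtoQq P) x y.
Proof.
move=> b0 xyE Pa bP.
have [A [ca ca0 aE]] := rat_poly_scale a; have [B [cb cb0 bE]] := rat_poly_scale b.
have caQ : ca%:~R != 0 :> rat by rewrite intr_eq0.
have cbQ : cb%:~R != 0 :> rat by rewrite intr_eq0.
have scaleE c (u : {poly int}) : pZtoQ (c *: u) = c%:~R *: pZtoQ u.
  by rewrite /pZtoQ linearZ.
have {}aE : pZtoQ A = ca%:~R *: a by rewrite aE scalerA mulfV ?scale1r.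
have {}bE : pZtoQ B = cb%:~R *: b by rewrite bE scalerA mulfV ?scale1r.
exists P, (cb *: A), (ca *: B).
have E : pZtoQ (ca *: B) = (ca * cb)%:~R *: b.
  by rewrite scaleE bE scalerA intrM.
have c0 : (ca * cb)%:~R != 0 :> rat by rewrite intrM mulf_neq0.
split=> //.
- apply: contraNneq b0 => B0; move: E; rewrite B0 /pZtoQ rmorph0 => /esym/eqP.
  by rewrite scaler_eq0 (negPf c0).
- rewrite xyE /pZtoQq E scaleE aE scalerA -intrM (mulrC cb) -!mul_polyC.
  by rewrite !tofracM -mulf_div divff ?mul1r // tofrac_eq0 polyC_eq0.
- by rewrite scaleE aE scalerA dvdpZr ?mulf_neq0.
- by rewrite E coprimepZl.
Qed.

Theorem theorem1p2 (n : nat) (r : int) (n_gt0 : (0 < n)%N) :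
  Qq_congr
    (qint qX n * pZtoQq 'Phi_n ^+ 3)
    (\sum_(k < n)
       qX ^ (r * (n%:Z - k%:Z) ^+ 2 + (r - 1) * k%:Z)
       * qbinom qX (n + k)%N k ^ (2 * r)
       * qbinom qX n.-1 k ^ (2 * r))
    (qX ^ ((r - 1) * n%:Z + 1) * qint qX n
     - (r * (2 * r - 1) * (n%:Z - 1) ^+ 2)%:~R * qX * (1 - qX) ^+ 2 / 4
       * qint qX n ^+ 3).
Proof.
rewrite -/(binomial_sum qX n r) -/(binomial_sum_value qX n r).
pose P : {poly int} := (\prod_(d <- divisors n | d != 1%N) 'Phi_d) * 'Phi_n ^+ 3.
have PE : pZtoQ P = (\prod_(d <- divisors n | d != 1%N) PhiQ d) * PhiQ n ^+ 3.
  by rewrite /pZtoQ rmorphM rmorphXn rmorph_prod.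
have -> : qint qX n * pZtoQq 'Phi_n ^+ 3 = pZtoQq P.
  by rewrite qint_prod_PhiQ // /pZtoQq PE tofracM tofracXn.
have [n1|n_neq1] := eqVneq n 1%N.
  apply: (@Qq_congr_of_fraction _ _ _ 0 1);
    rewrite ?oner_neq0 ?dvdp0 ?coprime1p //.
  rewrite tofrac0 mul0r; apply/eqP; rewrite subr_eq0; apply/eqP.
  by rewrite n1; apply: binomial_sum1; exact: (one_sub_qX_neq0 (ltn0Sn 0)).
have n_gt1 : (1 < n)%N by rewrite ltn_neqAle eq_sym n_neq1.
have [b0 ab xE] :=
  frac_lowest_terms (binomial_sum qX n r - binomial_sum_value qX n r).
move: (_ %/ _) (_ %/ _) b0 ab xE => a b b0 ab xE.
(* Besides the Phi_n of [n], the modulus has three more. *)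
pose e d := if d == n then 4%N else 1%N.
have local d : d \in divisors n -> d != 1%N ->
    (PhiQ d ^+ e d %| a) /\ coprimep b (PhiQ d).
  rewrite -dvdn_divisors // => dn d1.
  have d_gt1 : (1 < d)%N by rewrite ltn_neqAle eq_sym d1 (dvdn_gt0 n_gt0).
  have := binomial_sum_cong_PhiQ r n_gt1 d_gt1 dn; rewrite /cong_mod xE /e.
  by case: ifP => _; apply: local_at_dvd; rewrite ?PhiQ_neq0.
pose s := [seq d <- divisors n | d != 1%N].
have sP d : d \in s -> [/\ d \in divisors n, d != 1%N & (0 < d)%N].
  rewrite mem_filter => /andP[d1 dn]; split=> //.
  by rewrite -dvdn_divisors // in dn; apply: dvdn_gt0 dn.
have s_uniq : uniq s by rewrite filter_uniq ?divisors_uniq.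
have ns : n \in s by rewrite mem_filter n_neq1 -dvdn_divisors ?dvdnn.
have {}PE : pZtoQ P = \prod_(d <- s) PhiQ d ^+ e d.
  rewrite PE -big_filter -/s (bigD1_seq n) //= [RHS](bigD1_seq n) //=.
  rewrite mulrAC -exprS /e eqxx; congr (_ * _).
  by apply: eq_bigr => d /negPf->.
apply: (Qq_congr_of_fraction b0 xE).
  rewrite PE; apply: dvdp_prod_coprime => // [d d' ds d's neq_dd'|d ds].
    have [_ _ d_gt0] := sP d ds; have [_ _ d'_gt0] := sP d' d's.
    by apply/coprimep_expl/coprimep_expr/coprimep_PhiQ_PhiQ.
  by have [dn d1 _] := sP d ds; have [] := local d dn d1.
rewrite PE big_seq; elim/big_ind: _ => [|u v ub vb|d ds]; first exact: coprimep1.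
  by rewrite coprimepMr ub vb.
have [dn d1 _] := sP d ds; have [_ cop] := local d dn d1.
exact: coprimep_expr.
Qed.
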